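(* Let $k$ be a field, $V$ a $k$-vector space, $f:V\to k$ a $k$-linear map, $\alpha,\beta\in k$, and $e\in V$ such that $f(e)=1$. Then: (i) $(V,M,e)$ is a unital associative algebra with unit $e$, where $M(v\otimes w)=f(v)w+f(w)v-f(v)f(w)e$; (ii) $(V,[\,,])$ is a Lie algebra, where $[v,w]=f(v)w-f(w)v$; (iii) $(V,\mu)$ is a Jordan algebra, where $\mu(v\otimes w)=f(v)w+f(w)v$; (iv) $(V,M_{\alpha,\beta})$ is a UJLA structure, where $M_{\alpha,\beta}(v\otimes w)=\alpha f(v)w+\beta f(w)v$.
   Context: A UJLA structure over a field $k$ is a pair $(V,\eta)$ with $V$ a $k$-vector space and $\eta:V\otimes V\to V$, $\eta(a\otimes b)=ab$, a linear map such that for all $a,b,c\in V$ (writing $a^2=aa$): $(ab)c+(bc)a+(ca)b=a(bc)+b(ca)+c(ab)$, and $(a^2b)a=a^2(ba)$, $(ab)a^2=a(ba^2)$, $(ba^2)a=(ba)a^2$, $a^2(ab)=a(a^2b)$. A Jordan algebra is a $k$-vector space with a commutative bilinear product satisfying $(a^2b)a=a^2(ba)$ for all $a,b$. *)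

(* Defs.v *)
From HB Require Import structures.
From mathcomp Require Import all_boot all_order all_algebra.

Set Implicit Arguments.
Unset Strict Implicit.
Unset Printing Implicit Defensive.

Import GRing.Theory.

Local Open Scope ring_scope.

(* A linear map V (x) V -> V is given by the corresponding bilinear map
   V -> V -> V, using the universal property of the tensor product.
   Products are raw functions, so that bilinearity is part of each
   predicate below. *)
Record bilinear_product (k : fieldType) (V : lmodType k) (m : V -> V -> V) :
    Prop := BilinearProduct {
  product_linear_left : forall w : V, linear (fun v : V => m v w);
  product_linear_right : forall v : V, linear (m v)
}.

Record unital_associative_algebra (k : fieldType) (V : lmodType k)
    (m : V -> V -> V) (e : V) : Prop := UnitalAssociativeAlgebra {
  assoc_bilinear : bilinear_product m;
  assoc_mulA : associative m;
  assoc_mul1l : left_id e m;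
  assoc_mul1r : right_id e m
}.

(* The bracket is required to be alternating, which is stronger than
   antisymmetric in characteristic 2. *)
Record lie_algebra (k : fieldType) (V : lmodType k) (br : V -> V -> V) :
    Prop := LieAlgebra {
  lie_bilinear : bilinear_product br;
  lie_alternating : forall a : V, br a a = 0;
  lie_jacobi : forall a b c : V,
    br a (br b c) + br b (br c a) + br c (br a b) = 0
}.

Record jordan_algebra (k : fieldType) (V : lmodType k) (m : V -> V -> V) :
    Prop := JordanAlgebra {
  jordan_bilinear : bilinear_product m;
  jordan_mulC : commutative m;
  jordan_identity : forall a b : V, m (m (m a a) b) a = m (m a a) (m b a)
}.

(* Here a^2 b = (a a) b and b a^2 = b (a a). *)
Record UJLA_structure (k : fieldType) (V : lmodType k) (m : V -> V -> V) :
    Prop := UJLAStructure {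
  UJLA_bilinear : bilinear_product m;
  UJLA_cyclic : forall a b c : V,
    m (m a b) c + m (m b c) a + m (m c a) b
      = m a (m b c) + m b (m c a) + m c (m a b);
  UJLA_sql_r : forall a b : V, m (m (m a a) b) a = m (m a a) (m b a);
  UJLA_mul_sq : forall a b : V, m (m a b) (m a a) = m a (m b (m a a));
  UJLA_sqr_r : forall a b : V, m (m b (m a a)) a = m (m b a) (m a a);
  UJLA_sq_mul : forall a b : V, m (m a a) (m a b) = m a (m (m a a) b)
}.

(* Main.v *)
(** Each product sends (v, w) to a combination of v, w and e whose coefficients
    are polynomials in f v and f w, and f of it is again such a polynomial. So
    both sides of each axiom lie in the span of its arguments and e, and the
    axiom follows from the equality of the coefficients, a polynomial identity
    in the field. *)

Require Import Defs.
From HB Require Import structures.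
From mathcomp Require Import all_boot all_order all_algebra.
From mathcomp Require Import ring.

Set Implicit Arguments.
Unset Strict Implicit.
Unset Printing Implicit Defensive.

Import GRing.Theory.

Local Open Scope ring_scope.

(** Four slots suffice: an axiom involves at most three vectors besides [e]. *)
Definition lincomb (k : fieldType) (V : lmodType k) (a b c d : V)
    (x y z t : k) : V :=
  x *: a + y *: b + z *: c + t *: d.

Section LincombTheory.

Variables (k : fieldType) (V : lmodType k) (a b c d : V).
Local Notation L := (lincomb a b c d).

Lemma lincomb1 x : x *: a = L x 0 0 0.
Proof. by rewrite /lincomb !scale0r !addr0. Qed.

Lemma lincomb2 x : x *: b = L 0 x 0 0.
Proof. by rewrite /lincomb !scale0r add0r !addr0. Qed.

Lemma lincomb3 x : x *: c = L 0 0 x 0.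
Proof. by rewrite /lincomb !scale0r !add0r addr0. Qed.

Lemma lincomb4 x : x *: d = L 0 0 0 x.
Proof. by rewrite /lincomb !scale0r !add0r. Qed.

Lemma lincombD x y z t x' y' z' t' :
  L x y z t + L x' y' z' t' = L (x + x') (y + y') (z + z') (t + t').
Proof. by rewrite /lincomb !scalerDl 3!(addrACA _ (_ *: _)). Qed.

End LincombTheory.

(** Expands [f] and the scalings, then collects each side into one [lincomb]. Equal coefficients
    give equal vectors even when [a b c d] are dependent. *)
Ltac by_coefficients a b c d :=
  rewrite ?(linearP, linearD, linearB, linearZ) /=;
  rewrite ?(scalerDr, scalerA, scalerN) -?scaleNr;
  rewrite ?(lincomb1 a b c d, lincomb2 a b c d, lincomb3 a b c d,
            lincomb4 a b c d) ?lincombD;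
  congr lincomb; ring.

Theorem theorem6p4 (k : fieldType) (V : lmodType k) (f : {scalar V})
    (alpha beta : k) (e : V) (fe1 : f e = 1) :
  [/\ unital_associative_algebra
        (fun v w : V => f v *: w + f w *: v - (f v * f w) *: e) e,
      lie_algebra (fun v w : V => f v *: w - f w *: v),
      jordan_algebra (fun v w : V => f v *: w + f w *: v)
    & UJLA_structure
        (fun v w : V => (alpha * f v) *: w + (beta * f w) *: v)].
Proof.
split.
- split; first by split=> w x u v; by_coefficients u v w e.
  (* Expanding [f] of the inner products produces [f e]; it becomes 1 here, since [ring] would treat
     it as an unknown. *)
  + by move=> a b c; rewrite !linearB !linearD !linearZ /= fe1;
    by_coefficients a b c e.
  + by move=> a; rewrite /= fe1 mul1r scale1r addrK.
  + by move=> a; rewrite /= fe1 mulr1 scale1r addrAC subrr add0r.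
- split; first by split=> w x u v; by_coefficients u v w e.
  + by move=> a; rewrite subrr.
  (* Written as [0 *: a], the right side too becomes a [lincomb]. *)
  + by move=> a b c; rewrite -[RHS](scale0r a); by_coefficients a b c e.
- split; first by split=> w x u v; by_coefficients u v w e.
  + by move=> a b; rewrite addrC.
  (* Only [a] and [b] occur; [e] pads the last two slots with coefficient 0. *)
  + by move=> a b; by_coefficients a b e e.
- split; first by split=> w x u v; by_coefficients u v w e.
  + by move=> a b c; by_coefficients a b c e.
  all: by move=> a b; by_coefficients a b e e.
Qed.
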